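(* Let $f:\mathbb{N}\to\mathbb{N}$ be the Collatz map, let $N_1=\{n\in\mathbb{N}\mid n\equiv 1,5 \pmod 6\}$ and $N_2=f(N_1)=\{n\in\mathbb{N}\mid n\equiv 4,16\pmod{18}\}$, and let $P:N_1\cup N_2\to N_1\cup N_2$ be the first-return map for $f$ on $N_1\cup N_2$. Let $\mathcal{H}$ be a complex Hilbert space with orthonormal basis $\{e_n\}_{n\in N_1\cup N_2}$, let $T_1,T_2\in\mathcal{B}(\mathcal{H})$ be the bounded linear operators determined by $$T_1e_n=\begin{cases}e_{P(n)},& n\in N_1,\\ 0,& n\in N_2,\end{cases}\qquad T_2e_n=\begin{cases}0,& n\in N_1,\\ e_{P(n)},& n\in N_2,\end{cases}$$ and put $S_1=T_1^{*}T_2^{*}$, $S_2=T_2^{*}$. The following are equivalent: (i) $C^{*}(S_1,S_2)$ has no non-trivial reducing subspaces; (ii) the Collatz conjecture holds.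
   Context: $\mathbb{N}$ is the set of positive integers. The Collatz map is $f(n)=3n+1$ for $n$ odd and $f(n)=n/2$ for $n$ even. The Collatz conjecture is the statement: for every $n\in\mathbb{N}$ there is an integer $m\ge 0$ with $f^m(n)=1$, where $f^m$ is the $m$-th iterate ($f^0=\mathrm{id}$). The first-return map for $f$ on a non-empty set $\Sigma$ is $P(x)=f^{\tau(x)}(x)$, where $\tau(x)$ is the least positive integer $m$ with $f^m(x)\in\Sigma$, defined for those $x\in\Sigma$ for which such $m$ exists; for $\Sigma=N_1\cup N_2$ it is defined on all of $N_1\cup N_2$. $\mathcal{B}(\mathcal{H})$ is the algebra of bounded linear operators on $\mathcal{H}$. A $C^*$-algebra in $\mathcal{B}(\mathcal{H})$ is a norm-closed linear subspace of $\mathcal{B}(\mathcal{H})$ closed under products and adjoints; $C^*(S_1,S_2)$ is the $C^*$-algebra generated by $S_1,S_2$, i.e. the smallest $C^*$-algebra in $\mathcal{B}(\mathcal{H})$ containing $S_1$ and $S_2$. A reducing subspace of a $C^*$-algebra $\mathcal{A}\subseteq\mathcal{B}(\mathcal{H})$ is a closed subspace $\mathcal{M}\subseteq\mathcal{H}$ with $S\mathcal{M}\subseteq\mathcal{M}$ and $S^*\mathcal{M}\subseteq\mathcal{M}$ for all $S\in\mathcal{A}$; the trivial ones are $\{0\}$ and $\mathcal{H}$. *)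

(* Defs.v *)
(* MathComp / MathComp-Analysis *)
From HB Require Import structures.
From mathcomp Require Import all_boot all_order all_algebra.
From mathcomp Require Import zify.
From mathcomp Require Import all_classical all_reals all_analysis.
From mathcomp Require Import complex.

Set Implicit Arguments.
Unset Strict Implicit.
Unset Printing Implicit Defensive.

Import Order.TTheory GRing.Theory Num.Theory.
Import numFieldNormedType.Exports.

Local Open Scope classical_set_scope.
Local Open Scope ring_scope.

Section FirstReturn.
Local Open Scope nat_scope.

(* Only positive integers matter below; [collatz 0 = 0] is never used. *)
Definition collatz (n : nat) : nat := if odd n then 3 * n + 1 else n./2.

Definition collatz_conjecture : Prop :=
  forall n : nat, 0 < n -> exists m : nat, iter m collatz n = 1.

(* The first-return map at a point [x] that does return to [Sigma];
   [ex_minn ret] is the first-return time. *)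
Definition first_return (X : Type) (f : X -> X) (Sigma : pred X) (x : X)
    (ret : exists m, (0 < m) && Sigma (iter m f x)) : X :=
  iter (ex_minn ret) f x.

Lemma first_returnP (X : Type) (f : X -> X) (Sigma : pred X) (x : X)
    (ret : exists m, (0 < m) && Sigma (iter m f x)) :
  Sigma (first_return ret).
Proof. by rewrite /first_return; case: ex_minnP => m /andP[]. Qed.

Definition N1 : pred nat := [pred n | (n %% 6 == 1) || (n %% 6 == 5)].
Definition N2 : pred nat := [pred n | (n %% 18 == 4) || (n %% 18 == 16)].
Definition N12 : pred nat := [pred n | N1 n || N2 n].

Lemma collatz_N1 (n : nat) : N1 n -> collatz n = 3 * n + 1.
Proof.
rewrite /N1 /collatz /= => h; have -> // : odd n by lia.
Qed.

Lemma N2_image (n : nat) : N2 n <-> exists2 m, N1 m & n = collatz m.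
Proof.
split=> [h|[m h ->]]; last by rewrite (collatz_N1 h); move: h; rewrite /N1 /N2 /=; lia.
have h1 : N1 (n %/ 3) by move: h; rewrite /N1 /N2 /=; lia.
by exists (n %/ 3) => //; rewrite (collatz_N1 h1); move: h; rewrite /N2 /=; lia.
Qed.

Lemma collatz_returns_even (n : nat) : 0 < n -> ~~ odd n -> n %% 3 != 0 ->
  exists m, (0 < m) && N12 (iter m collatz n).
Proof.
elim/ltn_ind: n => n IH n0 en n3.
have cE : collatz n = n./2 by rewrite /collatz (negbTE en).
have [oh|eh] := boolP (odd n./2).
  by exists 1; rewrite /= cE /N12 /N1 /=; lia.
have [m /andP[m0 hm]] : exists m, (0 < m) && N12 (iter m collatz n./2).
  by apply: IH => //; lia.
by exists m.+1; rewrite iterSr cE hm.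
Qed.

Lemma collatz_returns (n : nat) : N12 n ->
  exists m, (0 < m) && N12 (iter m collatz n).
Proof.
move=> /orP[h|h]; last first.
  by apply: collatz_returns_even; move: h; rewrite /N2 /=; lia.
exists 1; apply/andP; split=> //; apply/orP; right.
by apply/N2_image; exists n.
Qed.

Definition idx : Type := {n : nat | N12 n}.

Definition collatz_return (n : idx) : idx :=
  exist _ (first_return (collatz_returns (valP n))) (first_returnP _).

End FirstReturn.

Record hilbertType (R : realType) := HilbertType {
  hilbert_sort :> completeNormedModType R[i];
  inner : {dot hilbert_sort for Num.conj};
  norm_inner : forall x : hilbert_sort, `|x| ^+ 2 = inner x x
}.

Definition linear_subspace (K : nzRingType) (V : lmodType K) (M : set V) : Prop :=
  M 0 /\ forall (a : K) (x y : V), M x -> M y -> M (a *: x + y).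

Section Operators.
Variables (R : realType) (H : hilbertType R).

(* [inner] is linear in the first and conjugate-linear in the second variable. *)
Local Notation "'[ x , y ]" := (@inner R H x y).

Definition linear_span (I : Type) (e : I -> H) : set H :=
  [set x | exists (s : seq I) (c : I -> R[i]), x = \sum_(i <- s) c i *: e i].

Definition orthonormal_basis (I : eqType) (e : I -> H) : Prop :=
  (forall i j : I, '[e i, e j] = (i == j)%:R) /\ closure (linear_span e) = setT.

(* Elements of $B(H)$ are represented by their underlying functions. *)
Definition bounded_operator (T : H -> H) : Prop :=
  linear T /\ exists C : R, forall x : H, `|T x| <= C%:C%C * `|x|.

(* The norm of [H] takes its values in [R[i]]; they are real, so [Re] only
   changes the type. *)
Definition opnorm (T : H -> H) : R :=
  sup [set complex.Re `|T x| | x in [set x : H | `|x| <= 1]].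

(* For a bounded operator the set below is a singleton (Riesz representation);
   [get] picks its element. *)
Definition adjoint (T : H -> H) : H -> H :=
  get [set S : H -> H | bounded_operator S /\
                        forall x y : H, '[T x, y] = '[x, S y]].

Definition norm_closed (A : set (H -> H)) : Prop :=
  forall T : H -> H, bounded_operator T ->
    (forall eps : R, 0 < eps -> exists2 S, A S & opnorm (S - T) < eps) -> A T.

Definition cstar_algebra (A : set (H -> H)) : Prop :=
  [/\ A `<=` bounded_operator,
      linear_subspace A,
      forall S T, A S -> A T -> A (S \o T),
      forall S, A S -> A (adjoint S)
    & norm_closed A].

Definition cstar_generated (S1 S2 : H -> H) : set (H -> H) :=
  smallest cstar_algebra [set S1; S2].

Definition reducing_subspace (A : set (H -> H)) (M : set H) : Prop :=
  [/\ closed M,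
      linear_subspace M,
      forall S, A S -> S @` M `<=` M
    & forall S, A S -> adjoint S @` M `<=` M].

End Operators.

(* Main.v *)
Require Import Defs.
From HB Require Import structures.
From mathcomp Require Import all_boot all_order all_algebra.
From mathcomp Require Import zify ring lra.
From mathcomp Require Import all_classical all_reals all_analysis.
From mathcomp Require Import complex.

Set Implicit Arguments.
Unset Strict Implicit.
Unset Printing Implicit Defensive.

Import Order.TTheory GRing.Theory Num.Theory.
Import numFieldNormedType.Exports.

Local Open Scope classical_set_scope.
Local Open Scope ring_scope.

(* The return map [P] is injective on [N1] and on [N2], so [S1] sends
   [e_(P (P n))] to [e_n] for [n] in [N1] and [S2] sends [e_(P n)] to [e_n] for
   [n] in [N2].  If every orbit reaches 1, a nonzero vector of a reducing
   subspace [M] has a nonzero coefficient, which the adjoints move to the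
   coefficient at 1; as [S1 e_1 = e_1] and every other basis vector is killed by
   a power of [S1^*], these powers converge strongly to the projection onto
   [e_1], so [e_1], and then every [e_n], lies in [M].  Conversely, [P] preserves
   the set of indices that reach 1, so the closed span of the corresponding
   basis vectors is reducing; it contains [e_1], hence is everything. *)

(** * The first-return map *)

Section CollatzReturn.
Local Open Scope nat_scope.

Definition reaches1 (n : nat) : Prop := exists m, iter m collatz n = 1.

Lemma reaches1_iter (k n : nat) : reaches1 (iter k collatz n) <-> reaches1 n.
Proof.
elim: k n => // k IH n; rewrite iterSr IH; split=> [[m hm]|[[|m] hm]].
- by exists m.+1; rewrite iterSr.
(* Here [n = 1], which lies on the cycle 1, 4, 2: two more steps lead from [collatz 1] back to 1. *)
- by exists 2; rewrite [n]hm.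
- by exists m; rewrite -iterSr.
Qed.

Lemma collatz_return_spec (n : idx) : exists k, [/\ 0 < k,
  val (collatz_return n) = iter k collatz (val n) &
  forall j, 0 < j -> N12 (iter j collatz (val n)) -> k <= j].
Proof.
rewrite /collatz_return /first_return /=; case: ex_minnP => k /andP[k0 _] kmin.
by exists k; split=> // j j0 hj; apply: kmin; rewrite j0.
Qed.

Lemma reaches1_return (n : idx) :
  reaches1 (val (collatz_return n)) <-> reaches1 (val n).
Proof. by have [k [_ -> _]] := collatz_return_spec n; exact: reaches1_iter. Qed.

Lemma collatz_return_N1 (n : idx) : N1 (val n) ->
  val (collatz_return n) = 3 * val n + 1.
Proof.
move=> hn; have [[|[|k]] [// _ -> kmin]] := collatz_return_spec n.
  exact: collatz_N1.
suff /(kmin 1 isT) : N12 (iter 1 collatz (val n)) by [].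
by apply/orP; right; apply/N2_image; exists (val n).
Qed.

(* Before the first return the orbit of a point of [N2] stays even: an odd
   iterate would be prime to 6. *)
Lemma collatz_return_N2 (n : idx) : N2 (val n) ->
  exists k, [/\ 0 < k, val n = 2 ^ k * val (collatz_return n) &
  forall j, j < k -> val n = 2 ^ j * iter j collatz (val n) /\
                     (0 < j -> ~~ N12 (iter j collatz (val n)))].
Proof.
move=> hn; have [k [k0 -> kmin]] := collatz_return_spec n.
have nret j : j < k -> 0 < j -> ~~ N12 (iter j collatz (val n)).
  by move=> jk j0; apply/negP => /(kmin _ j0); rewrite leqNgt jk.
suff halve j : j <= k -> val n = 2 ^ j * iter j collatz (val n).
  exists k; split=> // [|j jk]; first exact: halve.
  by split; [exact/halve/ltnW | exact: nret].
elim: j => [|j IH] jk; first by rewrite mul1n.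
rewrite [LHS](IH (ltnW jk)) expnSr -mulnA iterS; congr (_ * _).
have ev : ~~ odd (iter j collatz (val n)).
  have [->|j0] := posnP j; first by move: hn; rewrite /N2 /=; lia.
  apply/negP => od; have /negP := nret _ jk j0; apply.
  have n3 : val n %% 3 != 0 by move: hn; rewrite /N2 /=; lia.
  have : iter j collatz (val n) %% 3 != 0.
    by apply: contra n3 => /eqP h; rewrite (IH (ltnW jk)) -modnMmr h muln0.
  by move: od; rewrite /N12 /N1 /=; lia.
rewrite /collatz (negbTE ev); lia.
Qed.

Lemma collatz_return_N1_inj (m n : idx) : N1 (val m) -> N1 (val n) ->
  collatz_return m = collatz_return n -> m = n.
Proof.
move=> hm hn /(congr1 val); rewrite !collatz_return_N1 // => h.
by apply: val_inj; move: h => /=; lia.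
Qed.

(** With common return [p], [m = 2 ^ k * p] and [n = 2 ^ l * p]. If [k < l], then [m] is the iterate
    of [n] at time [l - k], strictly before the first return of [n], although [m] lies in [N12]. *)
Lemma collatz_return_N2_inj (m n : idx) : N2 (val m) -> N2 (val n) ->
  collatz_return m = collatz_return n -> m = n.
Proof.
move=> hm hn E.
have [k [k0 mE mret]] := collatz_return_N2 hm.
have [l [l0 nE nret]] := collatz_return_N2 hn.
apply: val_inj; rewrite nE mE E.
suff -> : k = l by [].
wlog kl : m n k l hm hn E k0 mE mret l0 nE nret / k < l => [W|].
  have [kl|lk|//] := ltngtP k l; first exact: (W m n).
  exact/esym/(W n m).
have [nE' nr'] := nret (l - k) ltac:(lia).
have /negP[] := nr' ltac:(lia).
suff <- : val m = iter (l - k) collatz (val n) by exact: valP.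
apply/eqP; rewrite -(eqn_pmul2l (m := 2 ^ (l - k))) ?expn_gt0 //.
by rewrite -nE' nE mE E mulnA -expnD subnK // ltnW.
Qed.

Definition idx1 : idx := exist _ 1 isT.

Lemma collatz_return2_idx1 : collatz_return (collatz_return idx1) = idx1.
Proof.
have h4 : val (collatz_return idx1) = 4 by rewrite collatz_return_N1.
have h2 : N2 (val (collatz_return idx1)) by rewrite h4.
have [k [k0 E _]] := collatz_return_N2 h2.
apply: val_inj; move: E (valP (collatz_return (collatz_return idx1))).
rewrite h4 [val idx1]/=; move: (val (collatz_return _)) => p.
(* [4 = 2 ^ k * p] with [0 < k] leaves [p = 2], which is not in [N12], or [p = 1]. *)
case: k k0 => // -[|k] _; rewrite ?expn1 => E hp.
  by have pE : p = 2 by [lia]; rewrite pE in hp.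
have /eqP : 2 ^ k * p = 1 by rewrite !expnS in E; lia.
by rewrite muln_eq1 => /andP[_ /eqP ->].
Qed.

(** Strong induction on a number of Collatz steps leading to 1. As 1 is itself in [N12], the first
    return happens no later than that arrival and lowers the number. *)
Lemma collatz_return_ind (Q : idx -> Prop) :
  (forall n : idx, reaches1 (val n)) -> Q idx1 ->
  (forall n : idx, val n != 1 -> Q (collatz_return n) -> Q n) ->
  forall n, Q n.
Proof.
move=> H1 Q1 QS n; have [m] := H1 n; elim/ltn_ind: m n => m IH n hm.
have [n1|n1] := eqVneq (val n) 1; first by have -> : n = idx1 by exact: val_inj.
apply: QS => //; have [k [k0 E kmin]] := collatz_return_spec n.
have m0 : 0 < m by case: m hm {IH} => // /eqP; rewrite (negbTE n1).
have km : k <= m by apply: kmin; rewrite ?hm.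
by apply: (IH (m - k)); rewrite ?E -?iterD ?subnK //; lia.
Qed.

Lemma N2_collatz_return (n : idx) : N1 (val n) -> N2 (val (collatz_return n)).
Proof.
move=> n1; apply/N2_image; exists (val n) => //.
by rewrite collatz_return_N1 // collatz_N1.
Qed.

(** The cases mirror the operators: [S2] undoes one return step from [N2], [S1] undoes two from
    [N1]. *)
Lemma N12_ind (Q : idx -> Prop) :
  (forall n : idx, reaches1 (val n)) -> Q idx1 ->
  (forall n : idx, N2 (val n) -> Q (collatz_return n) -> Q n) ->
  (forall n : idx, N1 (val n) -> n != idx1 ->
    Q (collatz_return (collatz_return n)) -> Q n) ->
  forall n, Q n.
Proof.
move=> H1 Q1 Q2 QN1 n.
(* A point of [N1] needs [Q] two returns ahead, so the induction also carries [Q] for the preimages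
   in [N1]. *)
suff [] : Q n /\ forall m, N1 (val m) -> collatz_return m = n -> Q m by [].
move: n; apply: (collatz_return_ind H1) => [|n n1 [Qn Qm]].
  split=> // m m1 /(congr1 val); rewrite collatz_return_N1 //.
  by rewrite [val idx1]/=; move: m1; rewrite /N1 /=; lia.
have [nN|nN] := orP (valP n).
  split=> [|m m1 mn]; first exact: (Qm n nN).
  by have := N2_collatz_return m1; rewrite mn; move: nN; rewrite /N1 /N2 /=; lia.
split=> [|m m1 mn]; first exact: Q2.
have [->//|m0] := eqVneq m idx1.
by apply: QN1; rewrite // mn.
Qed.

(** Every orbit enters [N12]: a multiple of 3 is halved until it is odd and then sent to [3n+1],
    prime to 3; a number prime to 3 is in [N1] when odd and returns by [collatz_returns_even] when
    even. *)
Lemma collatz_conjectureP :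
  collatz_conjecture <-> forall n : idx, reaches1 (val n).
Proof.
split=> [CC n|H n n0].
  by apply: CC; have := valP n; rewrite /N12 /N1 /N2 /=; lia.
suff [k hk] : exists k, N12 (iter k collatz n).
  by apply/(reaches1_iter k); exact: (H (exist (fun n => N12 n) _ hk)).
have coprime3 m : 0 < m -> m %% 3 != 0 -> exists k, N12 (iter k collatz m).
  move=> m0 m3; have [om|em] := boolP (odd m).
    by exists 0; rewrite /= /N12 /N1 /=; lia.
  by have [k /andP[_ hk]] := collatz_returns_even m0 em m3; exists k.
have [n3|] := eqVneq (n %% 3) 0; last exact: coprime3.
elim/ltn_ind: n n0 n3 => n IH n0 n3.
suff [k hk] : exists k, N12 (iter k collatz (collatz n)).
  by exists k.+1; rewrite iterSr.
rewrite /collatz; case: ifP => on; first by apply: coprime3; lia.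
by apply: IH; lia.
Qed.

End CollatzReturn.

(** * Hilbert spaces and adjoints *)

Section Hilbert.
Variables (R : realType) (H : hilbertType R).
Local Notation "''[' u , v ]" := (@inner R H u v).

Lemma innerC (x y : H) : '[x, y] = '[y, x]^*.
Proof. by rewrite hermC expr0 mul1r. Qed.

(** Balls of [H] have radii in [R[i]], but a positive element there is real, so real [eps]
    suffice. *)
Lemma closureP (M : set H) (x : H) : closure M x <->
  forall eps : R, 0 < eps -> exists2 y, M y & `|x - y| < eps%:C%C.
Proof.
split=> [Mx eps e0|Mx B /nbhs_ballP[eps /= e0 sB]].
  have eC : 0 < eps%:C%C :> R[i] by rewrite ltcR.
  have [y [My]] := Mx _ (nbhsx_ballx x _ eC).
  by rewrite -ball_normE => xy; exists y.
have eE : eps = (complex.Re eps)%:C%C by rewrite RRe_real ?gtr0_real.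
have [|y My xy] := Mx (complex.Re eps); first by rewrite -ltcR -eE.
by exists y; split=> //; apply: sB; rewrite -ball_normE /= eE.
Qed.

Lemma closedP (M : set H) : closed M <->
  forall x, (forall eps : R, 0 < eps -> exists2 y, M y & `|x - y| < eps%:C%C) -> M x.
Proof.
split=> [cM x /closureP|h x /closureP]; first by rewrite -(proj1 (closure_id _) cM).
exact: h.
Qed.

(** Pythagoras: the subtracted vector is the orthogonal projection of [x] onto the line of [y]. *)
Lemma norm_proj (x y : H) : y != 0 ->
  `|x - ('[x, y] / `|y| ^+ 2) *: y| ^+ 2 = `|x| ^+ 2 - `|'[x, y]| ^+ 2 / `|y| ^+ 2.
Proof.
move=> y0; set c := '[x, y]; set d := `|y| ^+ 2.
have d0 : 0 < d by rewrite exprn_gt0 ?normr_gt0.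
have dV : d^-1 \is Num.real by rewrite rpredV gtr0_real.
have cE : (c / d)^* * c = `|c| ^+ 2 / d.
  by rewrite normCK rmorphM /= (conj_Creal dV) mulrAC [_ * c]mulrC.
have rE : `|c| ^+ 2 / d \is Num.real by rewrite rpredM // rpredX ?normr_real.
rewrite norm_inner dnormB dnormZ linearZ /= -!norm_inner -/c -/d.
have -> : `|c / d| ^+ 2 * d = `|c| ^+ 2 / d.
  rewrite normrM normfV (gtr0_norm d0) exprMn exprVn -mulrA; congr (_ * _).
  by rewrite expr2 invfM -mulrA mulVf ?mulr1 ?gt_eqF.
by rewrite cE (conj_Creal rE) opprD addrA addrK.
Qed.

(** Cauchy-Schwarz, from the nonnegativity of the left side of [norm_proj]. *)
Lemma inner_le (x y : H) : `|'[x, y]| <= `|x| * `|y|.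
Proof.
have [->|y0] := eqVneq y 0; first by rewrite linear0r !normr0 mulr0.
have := exprn_ge0 2 (normr_ge0 (x - ('[x, y] / `|y| ^+ 2) *: y)).
rewrite norm_proj // subr_ge0 ler_pdivrMr ?exprn_gt0 ?normr_gt0 // -exprMn.
by rewrite ler_sqr // ?nnegrE ?mulr_ge0.
Qed.

Lemma parallelogram (x y : H) :
  `|x - y| ^+ 2 = 2 * `|x| ^+ 2 + 2 * `|y| ^+ 2 - `|x + y| ^+ 2.
Proof. rewrite !norm_inner dnormB dnormD; ring. Qed.

Definition rnorm (x : H) : R := complex.Re `|x|.

Lemma rnormE (x : H) : `|x| = (rnorm x)%:C%C.
Proof. by rewrite RRe_real ?normr_real. Qed.

Lemma rnorm_ge0 (x : H) : 0 <= rnorm x.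
Proof. by rewrite -ler0c -rnormE. Qed.

Lemma rnorm_distD (x y : H) : rnorm x <= rnorm y + rnorm (y - x).
Proof.
rewrite -lecR rmorphD /= -!rnormE distrC.
by have := ler_normD y (x - y); rewrite subrKC.
Qed.

Lemma rparallelogram (x y : H) :
  rnorm (x - y) ^+ 2 = 2 * rnorm x ^+ 2 + 2 * rnorm y ^+ 2 - rnorm (x + y) ^+ 2.
Proof.
apply: (@complexI R); rewrite rmorphB rmorphD !rmorphM rmorph_nat /= -!rnormE.
by rewrite -!expr2 parallelogram.
Qed.

Lemma normc_eq0_eps (a : R[i]) :
  (forall eps : R, 0 < eps -> `|a| <= eps%:C%C) -> a = 0.
Proof.
move=> h; apply/eqP; rewrite -normr_le0.
have aE : `|a| = (complex.Re `|a|)%:C%C by rewrite RRe_real ?normr_real.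
rewrite aE lecR; apply/ler_addgt0Pr => eps /h; rewrite aE lecR add0r; exact.
Qed.

(** Midpoints stay on the hyperplane [phi = 1], so by the parallelogram law its near-minimizers
    [D t] generate a Cauchy filter. The limit stays on the hyperplane because [phi] is bounded. *)
Lemma minimal_norm (K : R) (phi : {scalar H}) :
  0 < K -> (forall x, `|phi x| <= K%:C%C * `|x|) -> (exists x, phi x = 1) ->
  exists2 z, phi z = 1 & forall x, phi x = 1 -> `|z| <= `|x|.
Proof.
move=> K0 bphi [x0 phi0].
pose E := [set rnorm x | x in [set x | phi x = 1]].
have E0 : has_inf E.
  split; first by exists (rnorm x0); exists x0.
  by exists 0 => _ [x _ <-]; exact: rnorm_ge0.
pose d := inf E.
have dle x : phi x = 1 -> d <= rnorm x by move=> px; apply: ge_inf; [case: E0|exists x].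
have d0 : 0 <= d by apply: lb_le_inf; [case: E0| move=> _ [x _ <-]; exact: rnorm_ge0].
pose D (t : R) := [set x | phi x = 1 /\ rnorm x < d + t].
pose F := filter_from [set t : R | 0 < t] D.
have FF : ProperFilter F.
  apply: filter_from_proper.
    apply: filter_from_filter; first by exists 1 => /=.
    move=> s t s0 t0; exists (Num.min s t) => /=; first by rewrite lt_min s0.
    move=> x [px xd]; split; split=> //; apply: (lt_le_trans xd);
      by rewrite lerD2l ge_min lexx ?orbT.
  by move=> t t0; have [_ [x px <-] xd] := inf_adherent t0 E0; exists x.
have cF : cauchy F.
  apply: cauchy_exP => eps e0.
  have eE : eps = (complex.Re eps)%:C%C by rewrite RRe_real ?gtr0_real.
  have e0' : 0 < complex.Re eps by rewrite -ltcR -eE.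
  set r := complex.Re eps in eE e0'.
  (* For [x], [y] of norm below [d + t] and [x + y] of norm at least [2 d], the parallelogram law
     bounds the squared distance by [4 (d + t)^2 - 4 d^2 = t (8 d + 4 t)], which is below
     [t (8 d + 5)] as [t <= 1]. *)
  pose t := Num.min 1 (r ^+ 2 / (8 * d + 5)).
  have t0 : 0 < t by rewrite lt_min ltr01 divr_gt0 ?exprn_gt0 //; lra.
  have t1 : t <= 1 by rewrite ge_min lexx.
  have tr : t * (8 * d + 5) <= r ^+ 2.
    by rewrite -ler_pdivlMr ?ge_min ?lexx ?orbT //; lra.
  have [_ [x px <-] xd] := inf_adherent t0 E0.
  exists x, t => // y [py yd]; rewrite -ball_normE /= rnormE eE ltcR.
  have : phi (2^-1 *: (x + y)) = 1.
    by rewrite linearZ linearD /= px py mulVf ?pnatr_eq0.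
  move=> /dle; rewrite -lecR -rnormE normrZ normfV normr_nat => dxy.
  have {}dxy : 2 * d <= rnorm (x + y).
    by rewrite -lecR rmorphM /= -rnormE rmorph_nat -ler_pdivlMl.
  rewrite -[_ < _]ltr_sqr ?nnegrE ?rnorm_ge0 ?(ltW e0') // rparallelogram.
  have sqlt a b : 0 <= a -> a < b -> a ^+ 2 < b ^+ 2 :> R.
    by move=> a0 ab; rewrite ltr_sqr // nnegrE ltW // (le_lt_trans a0).
  have xs := sqlt _ _ (rnorm_ge0 x) xd; rewrite -/d in xs.
  have ys := sqlt _ _ (rnorm_ge0 y) yd.
  have ss : (2 * d) ^+ 2 <= rnorm (x + y) ^+ 2.
    by rewrite ler_sqr ?nnegrE ?rnorm_ge0 ?mulr_ge0.
  nra.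
have /cauchy_cvgP cvF := cF.
have lim_approx (eps t : R) : 0 < eps -> 0 < t ->
    exists2 y, D t y & rnorm (lim F - y) < eps.
  move=> e0 t0; have eC : 0 < eps%:C%C :> R[i] by rewrite ltcR.
  have FB : F (ball (lim F) eps%:C%C) := cvF _ (nbhsx_ballx _ _ eC).
  have FD : F (D t) by exists t.
  have [y [By Dy]] := filter_ex (filterI FB FD).
  by exists y => //; move: By; rewrite -ball_normE /= rnormE ltcR.
exists (lim F).
  apply/subr0_eq/normc_eq0_eps => eps e0.
  have [y [py _] yF] := lim_approx (eps / K) 1 (divr_gt0 e0 K0) ltr01.
  rewrite -py -linearB (le_trans (bphi _)) // rnormE -rmorphM /= lecR.
  by rewrite mulrC -ler_pdivlMr // ltW.
move=> x /dle dx; rewrite !rnormE lecR; apply/ler_addgt0Pr => eps e0.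
have e2 : 0 < eps / 2 by rewrite divr_gt0.
have [y [_ yd] yF] := lim_approx _ _ e2 e2.
have := rnorm_distD (lim F) y; rewrite /rnorm distrC -/(rnorm _); lra.
Qed.

(** The shortest [z] with [phi z = 1] is orthogonal to the kernel: removing its projection onto a
    kernel vector keeps [phi z = 1] and cannot shorten it. Pairing [x - phi x *: z] with [z] then
    gives [phi x], up to the factor [|z|^2]. *)
Lemma riesz (K : R) (phi : {scalar H}) : 0 < K ->
  (forall x, `|phi x| <= K%:C%C * `|x|) -> exists z, forall x, phi x = '[x, z].
Proof.
move=> K0 bphi.
have [phi0|] := pselect (forall x, phi x = 0).
  by exists 0 => x; rewrite phi0 linear0r.
move=> /existsNP[x0 /eqP x00].
have [|z pz zmin] := minimal_norm K0 bphi.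
  by exists ((phi x0)^-1 *: x0); rewrite linearZ /= mulVf.
have z0 : z != 0.
  by apply/eqP => z0; move/eqP: pz; rewrite z0 linear0 eq_sym oner_eq0.
have ort u : phi u = 0 -> '[z, u] = 0.
  move=> pu; have [->|u0] := eqVneq u 0; first by rewrite linear0r.
  have := zmin (z - ('[z, u] / `|u| ^+ 2) *: u).
  rewrite linearB linearZ /= pu mulr0 subr0 => /(_ pz).
  rewrite -ler_sqr ?nnegrE // norm_proj // lerBrDr gerDl.
  rewrite pmulr_lle0 ?invr_gt0 ?exprn_gt0 ?normr_gt0 // => h.
  by apply/eqP; rewrite -normr_eq0 -sqrf_eq0 eq_le h exprn_ge0.
exists (`|z| ^- 2 *: z) => x.
have /ort/eqP : phi (x - phi x *: z) = 0 by rewrite linearB linearZ /= pz mulr1 subrr.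
rewrite herm_eq0C linearBl linearZl_LR /= subr_eq0 -norm_inner => /eqP xz.
have zR : (`|z| ^- 2) \is Num.real by rewrite rpredV rpredX ?normr_real.
rewrite linearZ /= xz (conj_Creal zR) mulrCA mulVf ?mulr1 //.
by rewrite sqrf_eq0 normr_eq0.
Qed.

Lemma inner_ext (x y : H) : (forall z, '[z, x] = '[z, y]) -> x = y.
Proof.
move=> xy; apply/eqP; rewrite -subr_eq0 -(dnorm_eq0 (@inner R H)).
by rewrite linearB /= xy subrr.
Qed.

Lemma linear_pack (U V : lmodType R[i]) (T : U -> V) :
  linear T -> exists L : {linear U -> V}, T = L.
Proof.
move=> lT; pose T' := GRing.isLinear.Build R[i] U V _ T lT.
by exists (HB.pack_for {linear U -> V} T T').
Qed.

Lemma bounded_gt0 (T : H -> H) : bounded_operator T ->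
  exists2 C : R, 0 < C & forall x, `|T x| <= C%:C%C * `|x|.
Proof.
move=> [_ [C bT]]; exists (`|C| + 1) => [|x].
  by rewrite ltr_wpDl ?normr_ge0.
apply: (le_trans (bT x)); rewrite ler_wpM2r // lecR.
by rewrite (le_trans (ler_norm _)) // lerDl.
Qed.

(** Riesz, applied to each functional [x |-> <T x, y>], shows that the set in [adjoint] is nonempty,
    so [get] does pick one of its elements. *)
Lemma adjoint_spec (T : H -> H) : bounded_operator T ->
  bounded_operator (adjoint T) /\ forall x y, '[T x, y] = '[x, adjoint T y].
Proof.
move=> bT; apply: (getPex (P := [set S |
  bounded_operator S /\ forall x y, '[T x, y] = '[x, S y]])).
have [C C0 TC] := bounded_gt0 bT.
have [L TL] := linear_pack bT.1.
have /choice[S SP] : forall y, exists z, forall x, '[T x, y] = '[x, z].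
  move=> y.
  have lphi : linear_for *%R (fun x => '[T x, y]).
    by move=> a u v /=; rewrite TL linearP /= linearPl.
  pose phi := GRing.isLinear.Build R[i] H R[i] _ _ lphi.
  pose phi' := HB.pack_for {scalar H} (fun x => '[T x, y]) phi.
  (* The added 1 keeps the constant positive when [y = 0]. *)
  apply: (@riesz (C * (rnorm y + 1)) phi').
    by rewrite mulr_gt0 // ltr_wpDl // rnorm_ge0.
  move=> x; apply: (le_trans (inner_le _ _)).
  rewrite rmorphM rmorphD /= -rnormE mulrAC.
  by apply: ler_pM => //; rewrite lerDl.
exists (fun y => S y); split=> //; split.
  move=> a u v; apply: inner_ext => z.
  by rewrite -SP !linearD !linearZ /= !SP.
exists C => y; have [->|Sy0] := eqVneq (S y) 0.
  by rewrite normr0 mulr_ge0 // ler0c ltW.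
(* [|S y|^2 = <T (S y), y> <= C |S y| |y|]; the factor [|S y|] cancels. *)
rewrite -(ler_pM2l (x := `|S y|)) ?normr_gt0 // -expr2 norm_inner.
rewrite -(ger0_norm (dnorm_ge0 (@inner R H) (S y))) -SP.
apply: (le_trans (inner_le _ _)); rewrite mulrCA mulrA ler_wpM2r //.
Qed.

Lemma adjoint_bounded (T : H -> H) :
  bounded_operator T -> bounded_operator (adjoint T).
Proof. by case/adjoint_spec. Qed.

Lemma adjointP (T : H -> H) : bounded_operator T ->
  forall x y, '[T x, y] = '[x, adjoint T y].
Proof. by case/adjoint_spec. Qed.

Lemma adjointP' (T : H -> H) : bounded_operator T ->
  forall x y, '[adjoint T x, y] = '[x, T y].
Proof. by move=> bT x y; rewrite innerC -adjointP // -innerC. Qed.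

Lemma adjoint_unique (T S : H -> H) : bounded_operator T ->
  (forall x y, '[T x, y] = '[x, S y]) -> adjoint T = S.
Proof.
by move=> bT TS; apply/funext => y; apply: inner_ext => z; rewrite -adjointP.
Qed.

Lemma adjointK (T : H -> H) : bounded_operator T -> adjoint (adjoint T) = T.
Proof.
by move=> bT; apply: adjoint_unique; [exact: adjoint_bounded|exact: adjointP'].
Qed.

Lemma bounded_comp (S T : H -> H) :
  bounded_operator S -> bounded_operator T -> bounded_operator (S \o T).
Proof.
move=> bS bT; split=> [a x y /=|]; first by rewrite bT.1 bS.1.
have [C C0 SC] := bounded_gt0 bS; have [D D0 TD] := bounded_gt0 bT.
exists (C * D) => x /=; apply: (le_trans (SC _)).
by rewrite rmorphM -mulrA ler_wpM2l // ler0c ltW.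
Qed.

Lemma adjoint_comp (S T : H -> H) : bounded_operator S -> bounded_operator T ->
  adjoint (S \o T) = adjoint T \o adjoint S.
Proof.
move=> bS bT; apply: adjoint_unique; first exact: bounded_comp.
by move=> x y; rewrite /= (adjointP bS) (adjointP bT).
Qed.

Lemma bounded0 : bounded_operator (0 : H -> H).
Proof.
split=> [a x y|]; first by change (0 = a *: 0 + 0 :> H); rewrite scaler0 addr0.
by exists 0 => x; rewrite normr0 mul0r.
Qed.

Lemma bounded_lincomb (a : R[i]) (S T : H -> H) :
  bounded_operator S -> bounded_operator T -> bounded_operator (a *: S + T).
Proof.
move=> bS bT; split=> [b x y|].
  rewrite !fctE bS.1 bT.1 !scalerDr !scalerA [a * b]mulrC.
  by rewrite -!addrA; congr (_ + _); rewrite addrCA.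
have [C C0 SC] := bounded_gt0 bS; have [D D0 TD] := bounded_gt0 bT.
have /complex_realP[r aE] := normr_real a.
exists (r * C + D) => x; rewrite rmorphD rmorphM mulrDl /= -aE !fctE.
apply: (le_trans (ler_normD _ _)); rewrite lerD ?normrZ // -mulrA.
by rewrite ler_wpM2l.
Qed.

Lemma opnorm_ge (T : H -> H) (x : H) :
  bounded_operator T -> `|x| <= 1 -> rnorm (T x) <= opnorm T.
Proof.
move=> bT x1; apply: ub_le_sup; last by exists x.
have [C C0 TC] := bounded_gt0 bT; exists C => _ [y y1 <-].
rewrite -lecR -rnormE; apply: (le_trans (TC y)).
by rewrite ler_piMr // ler0c ltW.
Qed.

(** * Orthonormal bases *)

Section Basis.
Variables (I : eqType) (e : I -> H).
Hypothesis he : orthonormal_basis e.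

Lemma norm_basis i : `|e i| = 1.
Proof.
apply/eqP; rewrite -[_ == 1](eqrXn2 (n := 2)) // norm_inner expr1n.
by rewrite he.1 eqxx.
Qed.

Lemma basis_approx (x : H) (eps : R) : 0 < eps ->
  exists (s : seq I) (c : I -> R[i]),
    `|x - \sum_(i <- s) c i *: e i| < eps%:C%C.
Proof.
move=> e0; have : closure (linear_span e) x by rewrite he.2.
move=> /closureP/(_ _ e0)[y [s [c ->]] xy].
by exists s, c.
Qed.

(** Split a finite combination close to [y] into [y1], indexed by [O], and the rest [y2]. As [y1] is
    orthogonal to [y - y2], dropping it does not worsen the approximation, and [y2] is orthogonal to
    [x]. *)
Lemma basis_orthogonal (O : set I) (x y : H) :
  (forall i, ~ O i -> '[x, e i] = 0) -> (forall i, O i -> '[y, e i] = 0) ->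
  '[x, y] = 0.
Proof.
move=> xO yO; apply: normc_eq0_eps => eps e0.
have d0 : 0 < eps / (rnorm x + 1) by rewrite divr_gt0 // ltr_wpDl // rnorm_ge0.
have [s [c yc]] := basis_approx y d0.
pose y1 := \sum_(i <- s | `[< O i >]) c i *: e i.
pose y2 := \sum_(i <- s | ~~ `[< O i >]) c i *: e i.
have sumE : \sum_(i <- s) c i *: e i = y1 + y2 by rewrite (bigID (fun i => `[< O i >])).
have xy2 : '[x, y2] = 0.
  rewrite linear_sumr big1 // => i /asboolPn Oi.
  by rewrite linearZ /= xO // mulr0.
have y2y1 : '[y - y2, y1] = 0.
  rewrite linear_sumr big1 // => i /asboolP Oi.
  rewrite linearZ /= linearBl /= yO // linear_sumlz.
  rewrite big1 ?subr0 ?mulr0 // => j /asboolPn Oj.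
  rewrite linearZl_LR /= he.1; case: eqVneq => [ji|_]; last by rewrite mulr0.
  by rewrite ji in Oj.
have yy2 : `|y - y2| <= (eps / (rnorm x + 1))%:C%C.
  apply: le_trans (ltW yc); rewrite -[_ <= _]ler_sqr ?nnegrE //.
  rewrite sumE [y1 + y2]addrC opprD addrA !norm_inner (hnormBd y2y1).
  by rewrite lerDl dnorm_ge0.
have -> : '[x, y] = '[x, y - y2] by rewrite linearB /= xy2 subr0.
apply: (le_trans (inner_le _ _)).
apply: (le_trans (ler_wpM2l (normr_ge0 x) yy2)).
rewrite rnormE -rmorphM lecR mulrCA ler_piMr ?(ltW e0) //.
by rewrite ler_pdivrMr ?mul1r ?lerDl // ltr_wpDl // rnorm_ge0.
Qed.

Lemma basis_total (x : H) : (forall i, '[x, e i] = 0) -> x = 0.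
Proof.
move=> x0; apply/eqP; rewrite -(dnorm_eq0 (@inner R H)); apply/eqP.
by apply: (@basis_orthogonal set0) => // i _.
Qed.

Lemma basis_ext (x y : H) : (forall i, '[x, e i] = '[y, e i]) -> x = y.
Proof.
by move=> xy; apply/subr0_eq/basis_total => i; rewrite linearBl /= xy subrr.
Qed.

(** Agreement on the basis says that [adjoint S z] and [adjoint T z] have the same coefficients. *)
Lemma bounded_basis_ext (S T : H -> H) : bounded_operator S ->
  bounded_operator T -> (forall i, S (e i) = T (e i)) -> S = T.
Proof.
move=> bS bT ST; apply/funext => x; apply: inner_ext => z.
rewrite !(innerC z) (adjointP bS) (adjointP bT); congr (_^*).
suff -> : adjoint S z = adjoint T z by [].
by apply: basis_ext => i; rewrite !adjointP' // ST.
Qed.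

Lemma closed_subspace_basis (M : set H) : closed M -> linear_subspace M ->
  (forall i, M (e i)) -> M = setT.
Proof.
move=> /closedP cM [M0 ML] Me; apply/seteqP; split=> // x _.
apply: cM => eps e0; have /closureP/(_ _ e0)[_ [s [c ->]] xs] : closure (linear_span e) x.
  by rewrite he.2.
exists (\sum_(i <- s) c i *: e i) => //.
by elim: (s) => [|i t IH]; rewrite ?big_nil // big_cons; exact: ML.
Qed.

End Basis.

(* A partial isometry is a contraction:
   [|T x|^2 = <T^* T x, x> <= |T^* T x| |x| = |T x| |x|]. *)
Lemma partial_isometry_contraction (T : H -> H) : bounded_operator T ->
  T \o adjoint T \o T = T -> forall x, `|T x| <= `|x|.
Proof.
move=> bT TTT x.
have TT : `|adjoint T (T x)| = `|T x|.
  apply/eqP; rewrite -(eqrXn2 (n := 2)) // !norm_inner adjointP' //.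
  by rewrite -[T (adjoint T (T x))]/((T \o adjoint T \o T) x) TTT.
have [->|Tx0] := eqVneq (T x) 0; first by rewrite normr0.
rewrite -(ler_pM2l (x := `|T x|)) ?normr_gt0 // -expr2 norm_inner.
rewrite -(ger0_norm (dnorm_ge0 (@inner R H) (T x))) (adjointP bT).
by apply: (le_trans (inner_le _ _)); rewrite TT mulrC.
Qed.

(** * Operators that respect a splitting of the basis *)

Section BlockDiagonal.
Variables (I : eqType) (e : I -> H) (O : set I).
Hypothesis he : orthonormal_basis e.

(** The commutant of the orthogonal projection onto [block], written with matrix coefficients. *)
Definition block_diagonal : set (H -> H) :=
  [set T | bounded_operator T /\
           forall i j, ~ (O i <-> O j) -> '[T (e i), e j] = 0].

(** The closed span of the [e i] with [i] in [O]. *)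
Definition block : set H := [set x | forall i, ~ O i -> '[x, e i] = 0].

Lemma block_diagonal_adjoint (T : H -> H) :
  block_diagonal T -> block_diagonal (adjoint T).
Proof.
move=> [bT TO]; split; first exact: adjoint_bounded.
move=> i j Oij; rewrite adjointP' // innerC TO ?conjC0 //; tauto.
Qed.

Lemma block_diagonal_comp (S T : H -> H) :
  block_diagonal S -> block_diagonal T -> block_diagonal (S \o T).
Proof.
move=> dS dT; split=> [|i j Oij]; first exact: bounded_comp dS.1 dT.1.
rewrite /= (adjointP dS.1).
(* [T (e i)] is supported on the side of [i], and [adjoint S (e j)] on the side of [j]. *)
apply: (basis_orthogonal he (O := [set k | O i <-> O k])) => k; first exact: dT.2.
move=> /= Oik; apply: (block_diagonal_adjoint dS).2; tauto.
Qed.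

Lemma block_diagonal_cstar : cstar_algebra block_diagonal.
Proof.
split.
- by move=> T [].
- split; first by split; [exact: bounded0 | move=> i j _; exact: linear0l].
  move=> a S T [bS SO] [bT TO]; split; first exact: bounded_lincomb.
  move=> i j Oij; rewrite !fctE linearPl /= SO // TO //.
  by rewrite mulr0 addr0.
- exact: block_diagonal_comp.
- exact: block_diagonal_adjoint.
- move=> T bT Tlim; split=> // i j Oij; apply: normc_eq0_eps => eps e0.
  have [S [bS SO] ST] := Tlim _ e0.
  have bST : bounded_operator (S - T).
    rewrite addrC -scaleN1r; exact: bounded_lincomb.
  (* [S] has no coefficient across the blocks, so that of [T] is bounded by the operator norm of
     [S - T]. *)
  have -> : '[T (e i), e j] = - '[(S - T) (e i), e j].
    by rewrite !fctE linearBl /= SO // sub0r opprK.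
  rewrite normrN (le_trans (inner_le _ _)) // (norm_basis he) mulr1 rnormE lecR.
  by rewrite (le_trans _ (ltW ST)) // opnorm_ge ?(norm_basis he).
Qed.

Lemma block_diagonal_stable (T : H -> H) (x : H) :
  block_diagonal T -> block x -> block (T x).
Proof.
move=> dT bx i Oi; rewrite (adjointP dT.1).
apply: (basis_orthogonal he (O := O)) => // j Oj.
apply: (block_diagonal_adjoint dT).2; tauto.
Qed.

Lemma block_subspace : linear_subspace block.
Proof.
split=> [i _|a x y bx bY i Oi]; first exact: linear0l.
by rewrite linearPl /= bx // bY // mulr0 addr0.
Qed.

Lemma block_closed : closed block.
Proof.
apply/closedP => x xlim i Oi; apply: normc_eq0_eps => eps e0.
have [y yO xy] := xlim _ e0.
rewrite -[X in `|X|]subr0 -(yO i Oi) -linearBl /=.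
by rewrite (le_trans (inner_le _ _)) // (norm_basis he) mulr1 ltW.
Qed.

End BlockDiagonal.
End Hilbert.

(** * The algebra of the Collatz map *)

Section CollatzOperators.
Variables (R : realType) (H : hilbertType R) (e : idx -> H).
Hypothesis he : orthonormal_basis e.
Variables T1 T2 : H -> H.
Hypotheses (bT1 : bounded_operator T1) (bT2 : bounded_operator T2).
Hypothesis hT1 : forall n : idx,
  T1 (e n) = if N1 (val n) then e (collatz_return n) else 0.
Hypothesis hT2 : forall n : idx,
  T2 (e n) = if N2 (val n) then e (collatz_return n) else 0.
Local Notation "''[' u , v ]" := (@inner R H u v).
Local Notation S1 := (adjoint T1 \o adjoint T2).
Local Notation S2 := (adjoint T2).
Local Notation algebra := (cstar_generated S1 S2).

(** Compare coefficients: the one at [m] is [<e_(P n), T e_m>], which by injectivity of [P] on [N]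
    is 1 for [m = n] and 0 otherwise. *)
Lemma adjoint_T_return (N : pred nat) (T : H -> H) : bounded_operator T ->
  (forall n, T (e n) = if N (val n) then e (collatz_return n) else 0) ->
  (forall m n : idx, N (val m) -> N (val n) ->
    collatz_return m = collatz_return n -> m = n) ->
  forall n : idx, N (val n) -> adjoint T (e (collatz_return n)) = e n.
Proof.
move=> bT hT inj n Nn; apply: (basis_ext he) => m.
rewrite adjointP' // hT he.1; case: ifPn => Nm.
  rewrite he.1; congr (_%:R); congr nat_of_bool.
  by apply/eqP/eqP => [/(inj _ _ Nn Nm)|->].
rewrite linear0r; case: eqVneq => // nm.
by rewrite nm (negbTE Nm) in Nn.
Qed.

Lemma S2_return (n : idx) : N2 (val n) -> S2 (e (collatz_return n)) = e n.
Proof. exact: (adjoint_T_return bT2 hT2 collatz_return_N2_inj). Qed.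

Lemma S1_return (n : idx) : N1 (val n) ->
  S1 (e (collatz_return (collatz_return n))) = e n.
Proof.
move=> n1; rewrite /= S2_return ?N2_collatz_return //.
exact: (adjoint_T_return bT1 hT1 collatz_return_N1_inj).
Qed.

Let bS1 : bounded_operator S1.
Proof. by apply: bounded_comp; exact: adjoint_bounded. Qed.

Lemma adjoint_S1 : adjoint S1 = T2 \o T1.
Proof. by rewrite adjoint_comp ?adjointK //; exact: adjoint_bounded. Qed.

Lemma adjoint_S1_basis (n : idx) : adjoint S1 (e n) =
  if N1 (val n) then e (collatz_return (collatz_return n)) else 0.
Proof.
rewrite adjoint_S1 /= hT1; case: ifP => n1; first by rewrite hT2 N2_collatz_return.
by have [L ->] := linear_pack bT2.1; rewrite linear0.
Qed.

(** [adjoint S1] is a partial isometry: on each basis vector that it does not kill, [S1] undoes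
    it. *)
Lemma adjoint_S1_contraction (x : H) : `|adjoint S1 x| <= `|x|.
Proof.
have bA := adjoint_bounded bS1.
apply: (partial_isometry_contraction bA); rewrite adjointK //.
apply: (bounded_basis_ext he) => // [|n].
  by apply: bounded_comp => //; exact: bounded_comp.
rewrite [LHS]/= -[adjoint T1 _]/(S1 _) adjoint_S1_basis; case: ifP => n1.
  by rewrite S1_return // adjoint_S1_basis n1.
have [L S1L] := linear_pack bS1.1; have [L' AL] := linear_pack bA.1.
by rewrite AL S1L !linear0.
Qed.

(** The double return is injective on [N1] and fixes 1. *)
Lemma collatz_return2_neq_idx1 (n : idx) : N1 (val n) -> n != idx1 ->
  collatz_return (collatz_return n) != idx1.
Proof.
move=> n1; apply: contraNneq => n21; apply/eqP/collatz_return_N1_inj => //.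
by apply: collatz_return_N2_inj; rewrite ?N2_collatz_return // collatz_return2_idx1.
Qed.

(* Under the Collatz conjecture, a basis vector other than the fixed vector
   [e idx1] of [S1] is killed by some power of [S1^*]. *)
Lemma adjoint_S1_nilpotent (n : idx) : (forall n : idx, reaches1 (val n)) ->
  n != idx1 -> exists k, forall j, (k <= j)%N -> iter j (adjoint S1) (e n) = 0.
Proof.
move=> CC.
have [L AL] := linear_pack (adjoint_bounded bS1).1.
have iter0 j : iter j (adjoint S1) 0 = 0.
  by elim: j => //= j ->; rewrite AL linear0.
move: n; apply: (N12_ind CC) => [|n n2 _ _|n n1 n0 IH _]; first by rewrite eqxx.
  (* [N2] is disjoint from [N1], so a single application already gives 0. *)
  exists 1%N => -[//|j] _; rewrite iterSr adjoint_S1_basis.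
  by case: ifP => // n1; move: n1 n2; rewrite /N1 /N2 /=; lia.
have [k hk] := IH (collatz_return2_neq_idx1 n1 n0).
by exists k.+1 => -[//|j] kj; rewrite iterSr adjoint_S1_basis n1 hk.
Qed.

(** * From the Collatz conjecture to irreducibility *)

Section Reducing.
Variable M : set H.
Hypothesis rM : reducing_subspace algebra M.

Lemma S1_algebra : algebra S1.
Proof. by apply: sub_gen_smallest; left. Qed.

Lemma S2_algebra : algebra S2.
Proof. by apply: sub_gen_smallest; right. Qed.

Lemma reducing_act (S : H -> H) (x : H) : algebra S -> M x -> M (S x).
Proof. by case: rM => _ _ MS _ AS Mx; apply: (MS S AS); exists x. Qed.

Lemma reducing_adjoint_act (S : H -> H) (x : H) : algebra S -> M x -> M (adjoint S x).
Proof. by case: rM => _ _ _ MS AS Mx; apply: (MS S AS); exists x. Qed.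

Hypothesis CC : forall n : idx, reaches1 (val n).

(** [<S2^* x, e_(P n)> = <x, S2 e_(P n)> = <x, e_n>] for [n] in [N2], and [S1^*] likewise moves a
    coefficient two returns ahead from [N1]. *)
Lemma reducing_coef (n : idx) :
  (exists2 x, M x & '[x, e n] != 0) -> exists2 x, M x & '[x, e idx1] != 0.
Proof.
move: n; apply: (N12_ind CC) => // [n n2 IH [x Mx xn]|n n1 _ IH [x Mx xn]]; apply: IH.
  exists (adjoint S2 x); first exact: reducing_adjoint_act S2_algebra Mx.
  by rewrite adjointP' ?S2_return //; exact: adjoint_bounded.
exists (adjoint S1 x); first exact: reducing_adjoint_act S1_algebra Mx.
by rewrite adjointP' // S1_return.
Qed.

Lemma reducing_basis (n : idx) : M (e idx1) -> M (e n).
Proof.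
move=> M1; move: n; apply: (N12_ind CC) => // [n n2 IH|n n1 _ IH].
  by rewrite -(S2_return n2); exact: reducing_act S2_algebra IH.
by rewrite -(S1_return n1); exact: reducing_act S1_algebra IH.
Qed.

(* The powers of [S1^*] converge strongly to the projection onto [e idx1]. *)
Lemma reducing_idx1 : (exists2 x, M x & '[x, e idx1] != 0) -> M (e idx1).
Proof.
move=> [x' Mx' x'1]; have [cM [M0 ML] _ _] := rM.
pose x := '[x', e idx1]^-1 *: x'.
have Mx : M x by rewrite /x -[_ *: _]addr0; exact: ML.
have x1 : '[x, e idx1] = 1 by rewrite /x linearZl_LR /= mulVf.
apply: ((closedP M).1 cM) => eps e0.
have [s [c xy]] := basis_approx he x (divr_gt0 e0 (ltr0Sn _ 1)).
set y := \sum_(i <- s) _ in xy.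
pose A := adjoint S1.
have iterM k z : M z -> M (iter k A z).
  by move=> Mz; elim: k => //= k; exact: reducing_adjoint_act S1_algebra.
have iter_le k z : `|iter k A z| <= `|z|.
  by elim: k => //= k; apply: le_trans; exact: adjoint_S1_contraction.
have iter_lin k : linear (iter k A).
  by elim: k => // k IH a u v; rewrite !iterS IH /A (adjoint_bounded bS1).1.
(* The sum [y] is finite, so one power of [A] kills all its basis vectors other than [e idx1].
   Asking for all later powers too lets the exponents be merged by [maxn]. *)
have [k Ak] : exists k, forall i, i \in s -> i != idx1 -> iter k A (e i) = 0.
  suff [k hk] : exists k, forall j, (k <= j)%N -> forall i, i \in s ->
      i != idx1 -> iter j A (e i) = 0 by exists k; exact: hk.
  elim: (s) => [|i t [k hk]]; first by exists 0%N.
  have [->|i1] := eqVneq i idx1.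
    exists k => j kj m; rewrite inE => /orP[/eqP->|]; first by rewrite eqxx.
    exact: hk.
  have [l hl] := adjoint_S1_nilpotent CC i1; exists (maxn k l) => j.
  rewrite geq_max => /andP[kj lj] m.
  by rewrite inE => /orP[/eqP-> _|]; [exact: hl|exact: hk].
have iter1 : iter k A (e idx1) = e idx1.
  by elim: (k) => //= j ->; rewrite /A adjoint_S1_basis /= collatz_return2_idx1.
have [L kL] := linear_pack (iter_lin k).
have Ay : iter k A y = '[y, e idx1] *: e idx1.
  rewrite kL linear_sum linear_sumlz scaler_suml /= !big_seq.
  apply: eq_bigr => i si; rewrite linearZ linearZl_LR /= -scalerA he.1; congr (_ *: _).
  have [->|i1] := eqVneq i idx1; first by rewrite scale1r -kL iter1.
  by rewrite scale0r -kL Ak.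
exists (iter k A x); first exact: iterM.
(* By [Ay] and [x1] the error depends on [x - y] alone; each of the two terms has norm at most
   [|x - y| < eps / 2]. *)
have -> : e idx1 - iter k A x = '[x - y, e idx1] *: e idx1 - iter k A (x - y).
  rewrite kL linearB opprB -kL Ay linearBl /= scalerBl x1 scale1r.
  by rewrite addrA subrK.
rewrite (splitr eps) rmorphD /=.
apply: (le_lt_trans (ler_normB _ _)); apply: ltrD.
  rewrite normrZ (norm_basis he) mulr1 (le_lt_trans (inner_le _ _)) //.
  by rewrite (norm_basis he) mulr1.
exact: le_lt_trans (iter_le _ _) xy.
Qed.

Lemma reducing_trivial : M = [set 0] \/ M = setT.
Proof.
have [cM lM _ _] := rM.
have [M0|] := pselect (M `<=` [set 0]).
  by left; apply/seteqP; split=> // _ ->; case: lM.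
move=> /existsNP[x /not_implyP[Mx /eqP x0]]; right.
apply: (closed_subspace_basis he) => // n; apply/reducing_basis/reducing_idx1.
have [n0|] := pselect (forall n, '[x, e n] = 0).
  by rewrite (basis_total he n0) eqxx in x0.
by move=> /existsNP[m /eqP xm]; apply: (@reducing_coef m); exists x.
Qed.

End Reducing.

(** * From irreducibility to the Collatz conjecture *)

Let O : set idx := [set n | reaches1 (val n)].

(** [P] preserves and reflects reaching 1, so [T1] and [T2] are block diagonal; the block-diagonal
    operators form a C*-algebra, which then contains the generated one. *)
Lemma algebra_block_diagonal : algebra `<=` block_diagonal e O.
Proof.
have T_block (N : pred nat) (T : H -> H) : bounded_operator T ->
    (forall n, T (e n) = if N (val n) then e (collatz_return n) else 0) ->
    block_diagonal e O T.
  move=> bT hT; split=> // i j Oij; rewrite hT; case: ifP => _; last exact: linear0l.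
  rewrite he.1; case: eqVneq => // ij; case: Oij; rewrite -ij.
  by split=> /reaches1_return.
apply: smallest_sub; first exact: block_diagonal_cstar.
have d2 := block_diagonal_adjoint (T_block _ _ bT2 hT2).
move=> _ [->|->] //; apply: (block_diagonal_comp he) => //.
exact: block_diagonal_adjoint (T_block _ _ bT1 hT1).
Qed.

Lemma reducing_block : reducing_subspace algebra (block e O).
Proof.
split.
- exact: block_closed.
- exact: block_subspace.
- by move=> S /algebra_block_diagonal dS _ [x bx <-]; exact: block_diagonal_stable.
- move=> S /algebra_block_diagonal dS _ [x bx <-].
  by apply: (block_diagonal_stable he) => //; exact: block_diagonal_adjoint.
Qed.

Lemma irreducible_reaches1 :
  (forall M, reducing_subspace algebra M -> M = [set 0] \/ M = setT) ->
  forall n : idx, reaches1 (val n).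
Proof.
move=> /(_ _ reducing_block) irr n.
have O1 : O idx1 by exists 0%N.
have : block e O (e idx1).
  by move=> i Oi; rewrite he.1; case: eqVneq => // i1; rewrite -i1 in Oi.
case: irr => [->|bT _].
  move=> /= e10; have := norm_basis he idx1; rewrite e10 normr0 => /eqP.
  by rewrite eq_sym oner_eq0.
(* If [n] did not reach 1, membership of [e n] in the block would make it orthogonal to itself. *)
apply: contrapT => On; have : block e O (e n) by rewrite bT.
by move=> /(_ n On); rewrite he.1 eqxx => /eqP; rewrite oner_eq0.
Qed.

End CollatzOperators.

Theorem theorem4p3p10 (R : realType) (H : hilbertType R) (e : idx -> H)
    (he : orthonormal_basis e)
    (T1 T2 : H -> H)
    (bT1 : bounded_operator T1) (bT2 : bounded_operator T2)
    (hT1 : forall n : idx, T1 (e n) = if N1 (val n) then e (collatz_return n) else 0)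
    (hT2 : forall n : idx, T2 (e n) = if N2 (val n) then e (collatz_return n) else 0)
    (S1 S2 : H -> H)
    (hS1 : S1 = adjoint T1 \o adjoint T2)
    (hS2 : S2 = adjoint T2) :
  (forall M : set H, reducing_subspace (cstar_generated S1 S2) M ->
     M = [set 0] \/ M = setT)
  <-> collatz_conjecture.
Proof.
rewrite hS1 hS2; split=> [irr|/collatz_conjectureP CC M rM].
  by apply/collatz_conjectureP; exact: (irreducible_reaches1 he bT1 bT2 hT1 hT2).
exact: (reducing_trivial he bT1 bT2 hT1 hT2 rM CC).
Qed.
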